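(* Let $G$ be a convex bipartite graph satisfying Property A and let $I$ be its corresponding interval graph. Then Algorithm 1 (described in the context), run on $G$ and $I$, always outputs a Hamiltonian cycle of $I$.
   Context: All graphs are finite, simple, connected and unweighted. A convex bipartite graph is a bipartite graph $G$ with bipartition $(X,Y)$ together with an ordering $X=(x_1,\ldots,x_n)$ such that for every $y\in Y$ the neighborhood $N_G(y)$ consists of consecutive vertices of this ordering; $n=|X|$. For $1\le p<q\le n$ let $X_{p..q}=\{x_p,\ldots,x_q\}$, $N_G[X_{p..q}]=\{y\in Y : N_G(y)\subseteq X_{p..q}\}$ and $N'_G[X_{p..q}]=\{y\in Y : |N_G(y)\cap X_{p..q}|\ge 2\}$. $G$ satisfies Property A if: (1) for all $1\le p<q\le n$ with $(p,q)\neq(1,n)$, $|N_G[X_{p..q}]|\le q-p$; (2) for every integer $j\in\{1,\ldots,n-1\}$ and all indices with $1\le p_1<q_1\le p_2<q_2\le\cdots\le p_j<q_j\le n$, $\left|\bigcup_{i=1}^j N'_G[X_{p_i..q_i}]\right|\ge\sum_{i=1}^j (q_i-p_i)$; (3) $|N_G[X_{1..n}]|=|N'_G[X_{1..n}]|=n$. The corresponding interval graph $I$ has $V(I)=X\cup Y$ and $E(I)=E(G)\cup\{\{y,y'\}: y\neq y'\in Y,\ N_G(y)\cap N_G(y')\neq\emptyset\}$. Its maximal cliques, ordered, are $C_i=\{x_i\}\cup N_G(x_i)$, $1\le i\le n$; $i$ is the height of $C_i$. For a vertex $v$, level$[v]$ is the largest $i$ with $v\in C_i$. A conductor of $C_i$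 is a vertex of $C_i\cap C_{i+1}$. Algorithm 1 builds a path with two endpoints labeled $A$ and $B$, visiting the cliques in increasing order of height; a vertex is ''unlabeled'' if it is not yet on the path. Step $i=1$: choose two conductors $y_1,y_2$ of $C_1$ with level$[y_1]$ minimum and level$[y_2]$ second minimum; the path is $(y_1,x_1,y_2)$ with $A=y_1$, $B=y_2$. Step $1<i<n$: if level$[A]=i$ (resp. level$[B]=i$), extend the path from that endpoint through $x_i$ to an unlabeled conductor $y$ of $C_i$ of minimum level, and $y$ becomes the new endpoint in place of the old one; otherwise (level$[A]>i$ and level$[B]>i$) extend in the same way from the endpoint of smaller level. Step $i=n$: join the endpoints $A$ and $B$ through $x_n$, closing the path into a cycle, which is output. *)

(* Defs.v *)
From mathcomp Require Import all_boot.

Set Implicit Arguments.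
Unset Strict Implicit.
Unset Printing Implicit Defensive.

(* A graph is an edge relation [e] on a finite type [V] of vertices.  The
   ordering (x_1, ..., x_n) is a function [x : nat -> V] read only at the
   indices 1, ..., n, so that all indices, heights and levels are 1-based. *)

Definition simple_graph (V : finType) (e : rel V) : Prop :=
  symmetric e /\ irreflexive e.

Definition connected_graph (V : finType) (e : rel V) : Prop :=
  forall u v : V, connect e u v.

Definition bipartition (V : finType) (e : rel V) (X Y : {set V}) : Prop :=
  [/\ X :|: Y = setT, [disjoint X & Y] &
      forall u v : V, e u v ->
        (u \in X) && (v \in Y) || (u \in Y) && (v \in X)].

Definition nbh (V : finType) (e : rel V) (v : V) : {set V} := [set u | e v u].

Definition Xint (V : finType) (x : nat -> V) (p q : nat) : {set V} :=
  [set v in [seq x i | i <- index_iota p q.+1]].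

Definition ordering_of (V : finType) (X : {set V}) (n : nat) (x : nat -> V)
  : Prop :=
  uniq [seq x i | i <- index_iota 1 n.+1] /\ X = Xint x 1 n.

Record convex_bipartite (V : finType) (e : rel V) (X Y : {set V})
    (n : nat) (x : nat -> V) : Prop := ConvexBipartite {
  cb_simple : simple_graph e;
  cb_connected : connected_graph e;
  cb_bipartition : bipartition e X Y;
  cb_ordering : ordering_of X n x;
  cb_consecutive : forall y : V, y \in Y ->
    exists p q : nat, [/\ 1 <= p, q <= n & nbh e y = Xint x p q]
}.

(* N_G[X_{p..q}] and N'_G[X_{p..q}] *)
Definition Nin (V : finType) (e : rel V) (Y : {set V}) (x : nat -> V)
    (p q : nat) : {set V} :=
  [set y in Y | nbh e y \subset Xint x p q].

Definition Ntwo (V : finType) (e : rel V) (Y : {set V}) (x : nat -> V)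
    (p q : nat) : {set V} :=
  [set y in Y | 2 <= #|nbh e y :&: Xint x p q|].

(* 1 <= p_1 < q_1 <= p_2 < q_2 <= ... <= p_j < q_j <= n *)
Definition interval_chain (n j : nat) (p q : nat -> nat) : Prop :=
  [/\ 1 <= p 1,
      forall i, 1 <= i <= j -> p i < q i,
      forall i, 1 <= i < j -> q i <= p i.+1 &
      q j <= n].

Record propertyA (V : finType) (e : rel V) (Y : {set V}) (n : nat)
    (x : nat -> V) : Prop := PropertyA {
  propA1 : forall p q : nat, 1 <= p -> p < q -> q <= n -> (p, q) <> (1, n) ->
    #|Nin e Y x p q| <= q - p;
  propA2 : forall (j : nat) (p q : nat -> nat),
    1 <= j <= n - 1 -> interval_chain n j p q ->
    \sum_(1 <= i < j.+1) (q i - p i)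
      <= #|\bigcup_(1 <= i < j.+1) Ntwo e Y x (p i) (q i)|;
  propA3 : #|Nin e Y x 1 n| = n /\ #|Ntwo e Y x 1 n| = n
}.

Definition interval_graph (V : finType) (e : rel V) (Y : {set V}) : rel V :=
  fun u v => e u v ||
    [&& u \in Y, v \in Y, u != v & nbh e u :&: nbh e v != set0].

Definition clique (V : finType) (e : rel V) (x : nat -> V) (i : nat)
  : {set V} := x i |: nbh e (x i).

Definition level (V : finType) (e : rel V) (n : nat) (x : nat -> V) (v : V)
  : nat := \max_(1 <= i < n.+1 | v \in clique e x i) i.

Definition conductors (V : finType) (e : rel V) (x : nat -> V) (i : nat)
  : {set V} := clique e x i :&: clique e x i.+1.

Definition min_level (V : finType) (e : rel V) (n : nat) (x : nat -> V)
    (S : {set V}) (y : V) : Prop :=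
  y \in S /\ forall z : V, z \in S -> level e n x y <= level e n x z.

(* The path built so far, listed from endpoint A to endpoint B. *)
Record state (V : finType) := State { endA : V; endB : V; vpath : seq V }.

(* All choices left open by the algorithm (ties between levels, and which
   endpoint to extend when both qualify) are nondeterministic.  The steps do
   not test adjacency: a run may a priori output a sequence that is no cycle. *)

Inductive first_step (V : finType) (e : rel V) (n : nat) (x : nat -> V)
  : state V -> Prop :=
| FirstStep (y1 y2 : V) :
    min_level e n x (conductors e x 1) y1 ->
    min_level e n x (conductors e x 1 :\ y1) y2 ->
    first_step e n x (State y1 y2 [:: y1; x 1; y2]).

(* At step [i] the endpoint [a] may be extended, [b] being the other one. *)
Definition extendable (V : finType) (e : rel V) (n : nat) (x : nat -> V)
    (i : nat) (a b : V) : Prop :=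
  level e n x a = i \/
  [/\ i < level e n x a, i < level e n x b & level e n x a <= level e n x b].

Definition unlabeled_conductors (V : finType) (e : rel V) (x : nat -> V)
    (i : nat) (s : seq V) : {set V} :=
  [set y in conductors e x i | y \notin s].

Inductive middle_step (V : finType) (e : rel V) (n : nat) (x : nat -> V)
    (i : nat) : state V -> state V -> Prop :=
| ExtendA (a b : V) (s : seq V) (y : V) :
    extendable e n x i a b ->
    min_level e n x (unlabeled_conductors e x i s) y ->
    middle_step e n x i (State a b s) (State y b [:: y, x i & s])
| ExtendB (a b : V) (s : seq V) (y : V) :
    extendable e n x i b a ->
    min_level e n x (unlabeled_conductors e x i s) y ->
    middle_step e n x i (State a b s) (State a y (rcons (rcons s (x i)) y)).

(* [reached e n x i st]: some execution is in state [st] after step [i]. *)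
Inductive reached (V : finType) (e : rel V) (n : nat) (x : nat -> V)
  : nat -> state V -> Prop :=
| ReachedFirst (st : state V) : first_step e n x st -> reached e n x 1 st
| ReachedMiddle (i : nat) (st st' : state V) :
    1 < i < n -> reached e n x i.-1 st -> middle_step e n x i st st' ->
    reached e n x i st'.

(* Step [n]; the cycle is a sequence whose last vertex is joined to the first. *)
Inductive outputs (V : finType) (e : rel V) (n : nat) (x : nat -> V)
  : seq V -> Prop :=
| Output (st : state V) :
    reached e n x n.-1 st -> outputs e n x (rcons (vpath st) (x n)).

Definition never_stuck (V : finType) (e : rel V) (n : nat) (x : nat -> V)
  : Prop :=
  (exists st : state V, first_step e n x st) /\
  (forall (i : nat) (st : state V), 1 < i < n -> reached e n x i.-1 st ->
     exists st' : state V, middle_step e n x i st st').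

Definition hamiltonian_cycle (V : finType) (r : rel V) (c : seq V) : Prop :=
  [/\ 3 <= size c, cycle r c, uniq c & forall v : V, v \in c].

(* Main.v *)
(** Each y in Y has an interval [l y, r y] of neighbours in X, and Property A
    gives |Y| = n, while for p < q a proper subinterval [p, q] contains at most
    q - p of these intervals.  The algorithm picks, for i = 1, ..., n-1, an
    unused interval covering both i and i+1 with smallest right end (twice for
    i = 1).  Fix c < n, and suppose that after step c-1 some unused interval
    ends at c, or that both endpoints of the path have level c.  Let k be
    smallest such that the picks of steps k, ..., c-1 all end by c.  If k > 1,
    the pick of step k-1 ends after c, so every unused interval covering k-1
    and k also ended after c at that time; hence the later picks lie in [k, c].
    Then an unused interval ending at c is one interval too many inside [k, c].
    So, when k = 1, are the c picks inside [1, c] by themselves.  When k > 1,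
    after step k-1 an endpoint has level > c, and one such endpoint survives,
    because the endpoint of smaller level is always the one extended.
    Consequently no step lacks a conductor and no two endpoints expire
    together.  The cycle only uses edges of G. *)

Require Import Defs.
From mathcomp Require Import all_boot zify.

(** * Analysis of the algorithm on the intervals [[l y], [r y]] *)

Section Run.

Variables (V : finType) (e : rel V) (Y : {set V}) (n : nat) (x : nat -> V).
Variables (l r : V -> nat).

Hypothesis e_sym : symmetric e.
Hypothesis lr : forall y, y \in Y -> [&& 1 <= l y, l y < r y & r y <= n].
Hypothesis card_Y : #|Y| = n.
Hypothesis card_nested : forall p q, 1 <= p -> p < q -> q <= n ->
  (p, q) <> (1, n) -> #|[set y in Y | (p <= l y) && (r y <= q)]| <= q - p.
Hypothesis x_notin_Y : forall i, 1 <= i <= n -> x i \notin Y.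
Hypothesis x_inj : forall i j, 1 <= i <= n -> 1 <= j <= n ->
  x i = x j -> i = j.
Hypothesis e_xY : forall i y, 1 <= i <= n -> y \in Y ->
  e (x i) y = (l y <= i <= r y).
Hypothesis conductorsE : forall i, 1 <= i < n ->
  conductors e x i = [set y in Y | l y <= i < r y].
Hypothesis levelE : forall y, y \in Y -> level e n x y = r y.

Let I := interval_graph e Y.

(** * Loop invariant *)

Definition labeled_within (s : seq V) (k c : nat) : {set V} :=
  [set y in Y | [&& y \in s, k <= l y & r y <= c]].

(* State after step [i]; the first disjunct says that all picks so far have
   level at most [c], and in the second one [k - 1] is the last step whose pick
   has level greater than [c]. *)
Definition tight (i c : nat) (a b : V) (s : seq V) : Prop :=
  i < #|labeled_within s 1 c| \/
  exists k, [/\ 1 < k <= i.+1, i.+1 - k <= #|labeled_within s k c|,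
    forall y, y \in Y -> y \notin s -> l y < k <= r y -> c < r y &
    c < r a \/ c < r b].

Record invariant (i : nat) (a b : V) (s : seq V) : Prop := Invariant {
  inv_path : exists t, [/\ s = a :: t, last a t = b & path I a t];
  inv_uniq : uniq s;
  inv_endA : [&& a \in Y, l a <= i & i < r a];
  inv_endB : [&& b \in Y, l b <= i & i < r b];
  inv_ends : i.+1 < n -> i.+1 < r a \/ i.+1 < r b;
  inv_card : #|[set y in Y | y \in s]| = i.+1;
  inv_x : forall j, 1 <= j <= n -> (x j \in s) = (j <= i);
  inv_unlabeled : forall y, y \in Y -> y \notin s -> i.+1 < n -> i.+1 < r y;
  inv_tight : forall c, i < c < n -> tight i c a b s
}.

(** * Symmetry between the two endpoints *)

Lemma I_sym : symmetric I.
Proof.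
move=> u v; rewrite /I /interval_graph e_sym setIC eq_sym.
by case: (u \in Y); case: (v \in Y).
Qed.

Lemma tight_swap i c a b s s' : s =i s' -> tight i c a b s -> tight i c b a s'.
Proof.
move=> ss'; have W k : labeled_within s k c = labeled_within s' k c.
  by apply/setP=> y; rewrite !inE ss'.
case=> [H|[k [H1 H2 H3 H4]]]; [by left; rewrite -W | right].
exists k; split=> //; first by rewrite -W.
  by move=> y yY; rewrite -ss'; apply: H3.
by case: H4; [right | left].
Qed.

(** Reversing the path exchanges its endpoints, which reduces extension at B to extension at A. *)
Lemma invariant_rev i a b s : invariant i a b s -> invariant i b a (rev s).
Proof.
case=> [[t [-> lt pt]] us iA iB ie ic ix iu it].
split=> //.
- exists (rev (belast a t)); split.
  + by rewrite lastI rev_rcons lt.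
  + case: t {pt us ic ix iu it} lt => [|z t] //= _.
    by rewrite rev_cons last_rcons.
  + rewrite -lt rev_path; apply: sub_path pt => u v; by rewrite I_sym.
- by rewrite rev_uniq.
- by move=> /ie [|]; [right | left].
- by rewrite -ic; apply: eq_card => y; rewrite !inE mem_rev.
- by move=> j ?; rewrite mem_rev ix.
- by move=> y yY; rewrite mem_rev; apply: iu.
- by move=> c /it; apply: tight_swap => y; rewrite mem_rev.
Qed.

(** * Consequences of tightness at c = i + 1 *)

Lemma tight_unlabeled i a b s y : i.+1 < n -> tight i i.+1 a b s ->
  y \in Y -> y \notin s -> r y != i.+1.
Proof.
move=> ltin T yY ys; apply/negP=> /eqP ry.
(* The unlabeled [y] also lies in [k, i + 1], hence the strict inequality for the labeled
   intervals. *)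
have nested k : 1 <= k -> k <= l y ->
    #|labeled_within s k i.+1| < i.+1 - k.
  move=> k1 ky; have := lr y yY; move=> /and3P[l1 l2 l3].
  apply: leq_trans (card_nested k i.+1 _ _ _ _); try lia; last first.
    by case=> *; lia.
  apply: proper_card; apply/properP; split.
    by apply/subsetP=> z; rewrite !inE => /and4P[-> _ -> ->].
  by exists y; rewrite !inE ?yY ?ky ?ry ?leqnn // (negbTE ys).
case: T => [H|[k [H1 H2 H3 H4]]].
  by have /and3P[? ? ?] := lr y yY; have := nested 1 isT; lia.
have [ky|ky] := leqP k (l y); first by have := nested k; lia.
by have := H3 y yY ys; rewrite ry ky => /(_ _); lia.
Qed.

(** The first disjunct of [tight] would put more than i intervals inside [1, i + 1]; the second
    contains the claim. *)
Lemma tight_ends i a b s : i.+1 < n -> 0 < i -> tight i i.+1 a b s ->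
  i.+1 < r a \/ i.+1 < r b.
Proof.
move=> ltin i0 [H|[k []//]].
have neq : (1, i.+1) <> (1, n) by case; lia.
have := card_nested 1 i.+1 isT i0 (ltnW ltin) neq.
suff : #|labeled_within s 1 i.+1| <=
       #|[set y in Y | (1 <= l y) && (r y <= i.+1)]| by lia.
by apply/subset_leq_card/subsetP=> z; rewrite !inE => /and4P[-> _ -> ->].
Qed.

Lemma invariant_intro i a b s :
  0 < i < n -> (exists t, [/\ s = a :: t, last a t = b & path I a t]) ->
  uniq s -> [&& a \in Y, l a <= i & i < r a] ->
  [&& b \in Y, l b <= i & i < r b] -> #|[set y in Y | y \in s]| = i.+1 ->
  (forall j, 1 <= j <= n -> (x j \in s) = (j <= i)) ->
  (forall y, y \in Y -> y \notin s -> i < r y) ->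
  (forall c, i < c < n -> tight i c a b s) ->
  invariant i a b s.
Proof.
move=> i0 ps us iA iB ic ix iu it; split=> //.
  by move=> ltin; apply: (tight_ends _ _ _ s) => //; [lia | apply: it; lia].
move=> y yY ys ltin.
have T : tight i i.+1 a b s by apply: it; lia.
by have := tight_unlabeled _ _ _ _ _ ltin T yY ys; have := iu y yY ys; lia.
Qed.

(** * One middle step *)

Lemma min_level_exists (S : {set V}) z : z \in S ->
  exists y, min_level e n x S y.
Proof.
move=> zS; case: (arg_minnP (P := mem S) (level e n x) zS) => y yS ymin.
by exists y.
Qed.

Lemma unlabeled_conductorsE i s y : 1 <= i < n ->
  (y \in unlabeled_conductors e x i s) =
  [&& y \in Y, y \notin s & l y <= i < r y].
Proof.
move=> Hi; rewrite /unlabeled_conductors conductorsE // !inE -andbA.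
by do !bool_congr.
Qed.

Lemma tight_step i c a b s y : i.+1 < c < n ->
  a \in Y -> b \in Y -> i < r a -> i < r b ->
  extendable e n x i.+1 a b ->
  min_level e n x (unlabeled_conductors e x i.+1 s) y ->
  tight i c a b s -> tight i.+1 c y b [:: y, x i.+1 & s].
Proof.
move=> lc aY bY ra rb ext [yS ymin] T.
have Hi : 1 <= i.+1 < n by lia.
move: yS; rewrite unlabeled_conductorsE // => /and3P[yY ys ly].
have {}ymin z : z \in Y -> z \notin s -> l z <= i.+1 < r z -> r y <= r z.
  move=> zY zs lz; rewrite -!levelE //; apply: ymin.
  by rewrite unlabeled_conductorsE // zY zs lz.
have count k : k <= l y -> r y <= c ->
    #|labeled_within s k c| < #|labeled_within [:: y, x i.+1 & s] k c|.
  move=> ky yc; apply: proper_card; apply/properP; split.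
    by apply/subsetP=> z; rewrite !inE => /and4P[-> -> -> ->]; rewrite !orbT.
  by exists y; rewrite !inE ?eqxx ?yY ?ky ?yc // (negbTE ys).
have [yc|yc] := leqP (r y) c; last first.
  right; exists i.+2; split=> //; [lia | lia | | by left].
  move=> z zY; rewrite !inE !negb_or => /and3P[_ _ zs] lz.
  by apply: leq_trans yc (ymin z zY zs _); lia.
case: T => [H|[k [H1 H2 H3 H4]]].
  by left; have /and3P[? ? ?] := lr y yY; have := count 1; lia.
right; exists k; split=> //; first lia.
(* Here [r y <= c], so [H3] rules out [l y < k]: the pick lies in [k, c]. *)
- have := count k; have := H3 y yY ys; lia.
- by move=> z zY; rewrite !inE !negb_or => /and3P[_ _ zs]; apply: H3.
(* The endpoint [a] being replaced is the one expiring or of smaller level, so [b] has level above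
   c. *)
- by right; move: ext; rewrite /extendable !levelE // => -[|[]]; lia.
Qed.

Lemma invariant_step i a b s y : 0 < i -> i.+1 < n -> invariant i a b s ->
  extendable e n x i.+1 a b ->
  min_level e n x (unlabeled_conductors e x i.+1 s) y ->
  invariant i.+1 y b [:: y, x i.+1 & s].
Proof.
move=> i0 ltin inv ext ymin; have Hi : 1 <= i.+1 < n by lia.
case: (inv) => [[t [st lt pt]] us /and3P[aY la ra] /and3P[bY lb rb]].
move=> ie ic ix iu it.
have := ymin.1; rewrite unlabeled_conductorsE // => /and3P[yY ys /andP[ly ry]].
have xY : x i.+1 \notin Y by apply: x_notin_Y; lia.
have yx : y != x i.+1 by apply: contraNneq xY => <-.
have adj z : z \in Y -> l z <= i.+1 <= r z -> I (x i.+1) z.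
  by move=> zY lz; rewrite /I /interval_graph e_xY ?lz //; lia.
apply: invariant_intro; first lia.
- exists (x i.+1 :: s); split=> //; rewrite st //= pt andbT I_sym !adj //; lia.
- by rewrite /= inE negb_or yx ys us ix ?ltnn //; lia.
- by rewrite yY ly.
(* If [a] expires at i + 1, then [b] outlives it by [inv_ends]; otherwise extendability says so. *)
- rewrite bY; have := ie ltin.
  by move: ext; rewrite /extendable !levelE // => -[|[]]; lia.
- rewrite (cardsD1 y) !inE eqxx yY /= add1n; congr _.+1; rewrite -[RHS]ic.
  apply: eq_card => z; rewrite !inE.
  case: (eqVneq z y) => [->|zy] /=; first by rewrite (negbTE ys) andbF.
  by case: (eqVneq z (x i.+1)) => [->|//]; rewrite (negbTE xY).
- move=> j Hj; rewrite !inE ix //.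
  have -> : (x j == y) = false.
    by apply: contraTF yY => /eqP <-; apply: x_notin_Y.
  have -> : (x j == x i.+1) = (j == i.+1).
    by apply/eqP/eqP=> [/x_inj|->//]; apply; lia.
  lia.
- move=> z zY; rewrite !inE !negb_or => /and3P[_ _ zs]; exact: iu.
- move=> c lc; apply: (tight_step _ _ _ _ _ _ lc aY bY ra rb ext ymin).
  by apply: it; lia.
Qed.

(** Without such a conductor, all n - (i + 1) unlabeled intervals would lie in [i + 2, n], which
    holds at most n - (i + 2). *)
Lemma unlabeled_conductor_exists i a b s : 0 < i -> i.+1 < n ->
  invariant i a b s -> exists y, y \in unlabeled_conductors e x i.+1 s.
Proof.
move=> i0 ltin inv; case: (set_0Vmem (unlabeled_conductors e x i.+1 s)).
  2: by case=> y yS; exists y.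
move=> none; suff : #|Y :\: [set y in Y | y \in s]| <= n - i.+2.
  rewrite cardsD (setIidPr _) ?card_Y ?(inv_card _ _ _ _ inv); first lia.
  by apply/subsetP=> y; rewrite inE => /andP[].
have late y : y \in Y -> y \notin s -> i.+1 < l y.
  move=> yY ys; rewrite ltnNge; apply/negP=> ly.
  have := in_set0 y; rewrite -none unlabeled_conductorsE ?yY ?ys ?ly //=.
  by rewrite (inv_unlabeled _ _ _ _ inv) //.
(* [card_nested] needs p < q, so the one-point range i + 2 = n is treated apart. *)
have [lt2|ge2] := ltnP i.+2 n; last first.
  suff -> : Y :\: [set y in Y | y \in s] = set0 by rewrite cards0.
  apply/setP=> y; rewrite !inE; apply/negP=> /andP[].
  case yY: (y \in Y) => //= ys _.
  by have := late y yY ys; have := lr y yY; lia.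
apply: leq_trans (card_nested i.+2 n isT lt2 (leqnn n) _); last by case.
apply/subset_leq_card/subsetP=> y; rewrite !inE => /andP[].
case yY: (y \in Y) => //= ys _; rewrite late //.
by have := lr y yY; lia.
Qed.

(** * The first step *)

Lemma invariant_first y1 y2 : 1 < n ->
  min_level e n x (conductors e x 1) y1 ->
  min_level e n x (conductors e x 1 :\ y1) y2 ->
  invariant 1 y1 y2 [:: y1; x 1; y2].
Proof.
move=> n1 [y1S min1] [y2S min2].
move: y1S; rewrite conductorsE // inE => /and3P[y1Y l1 r1].
move: y2S; rewrite conductorsE // !inE => /and4P[y21 y2Y l2 r2].
have xY : x 1 \notin Y by apply: x_notin_Y; lia.
have y1x : y1 != x 1 by apply: contraNneq xY => <-.
have y2x : y2 != x 1 by apply: contraNneq xY => <-.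
have adj z : z \in Y -> l z <= 1 <= r z -> I (x 1) z.
  by move=> zY lz; rewrite /I /interval_graph e_xY ?lz //; lia.
have r12 : r y1 <= r y2.
  by rewrite -!levelE //; apply: min1; rewrite conductorsE // inE y2Y l2.
have l1y y : y \in Y -> 0 < l y by move/lr => /and3P[].
have cardE k c : k <= 1 -> r y2 <= c ->
    1 < #|labeled_within [:: y1; x 1; y2] k c|.
  move=> k1 yc; have := cards2 y1 y2; rewrite eq_sym y21 => <-.
  apply/subset_leq_card/subsetP=> z; rewrite !inE => /orP[] /eqP ->.
    rewrite y1Y eqxx (leq_trans r12 yc) andbT; exact: leq_trans k1 (l1y _ y1Y).
  rewrite y2Y eqxx !orbT yc andbT; exact: leq_trans k1 (l1y _ y2Y).
apply: invariant_intro; first lia.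
- exists [:: x 1; y2]; split=> //=; rewrite I_sym !adj //; lia.
- by rewrite /= !inE negb_or y1x eq_sym y21 eq_sym y2x.
- by rewrite y1Y l1.
- by rewrite y2Y l2.
- have := cards2 y1 y2; rewrite eq_sym y21 => <-; apply: eq_card => z.
  rewrite !inE; case: (eqVneq z y1) => [->|_]; first by rewrite y1Y.
  case: (eqVneq z y2) => [->|_]; first by rewrite y2Y !orbT.
  by case: (eqVneq z (x 1)) => [->|_]; rewrite ?(negbTE xY) // andbF.
- move=> j Hj; rewrite !inE.
  have xjY : x j \notin Y by apply: x_notin_Y.
  have -> : (x j == y1) = false by apply: contraNF xjY => /eqP ->.
  have -> : (x j == y2) = false by apply: contraNF xjY => /eqP ->.
  have -> : (x j == x 1) = (j == 1).
    by apply/eqP/eqP=> [/x_inj|->//]; apply; lia.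
  lia.
- by move=> y /lr /and3P[? ? ?] _; lia.
(* If [y2] ends by c, so does [y1], giving two picks in [1, c]. Otherwise k = 2: by the choice of
   [y2], the other conductors of C_1 end after c. *)
- move=> c lc; have [yc|yc] := leqP (r y2) c; first by left; apply: cardE.
  right; exists 2; split=> //; last by right.
  move=> y yY; rewrite !inE !negb_or => /and3P[yy1 _ _] ly.
  apply: leq_trans yc _; rewrite -!levelE //; apply: min2.
  by rewrite conductorsE // !inE yy1 yY; lia.
Qed.

(** * Executions of the algorithm *)

Lemma reached_invariant i st : 1 < n -> reached e n x i st ->
  0 < i < n /\ invariant i (endA st) (endB st) (vpath st).
Proof.
move=> n1; elim=> [_ [y1 y2 m1 m2]|{}i st1 st2 Hi _ [Hi1 inv] step].
  by split=> //; apply: invariant_first.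
split; first lia; case: i Hi Hi1 inv step => // i /= Hi Hi1 inv step.
case: step inv => a b s y ext ymin /= inv.
  by apply: invariant_step ext ymin => //; lia.
have {}ymin : min_level e n x (unlabeled_conductors e x i.+1 (rev s)) y.
  suff <- : unlabeled_conductors e x i.+1 s =
            unlabeled_conductors e x i.+1 (rev s) by [].
  by apply/setP=> z; rewrite !inE mem_rev.
have -> : rcons (rcons s (x i.+1)) y = rev [:: y, x i.+1 & rev s].
  by rewrite !rev_cons revK.
apply: invariant_rev; apply: invariant_step ext ymin; [lia | lia |].
exact: invariant_rev.
Qed.

(** The intervals that are not conductors of C_1 lie in [2, n], so at least two of the n are
    conductors. *)
Lemma first_step_exists : 1 < n -> exists st, first_step e n x st.
Proof.
move=> n1; have c2 : 1 < #|conductors e x 1|.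
  suff : #|Y :\: conductors e x 1| <= n - 2.
    rewrite cardsD (setIidPr _) ?card_Y; first lia.
    by rewrite conductorsE //; apply/subsetP=> y; rewrite inE => /andP[].
  rewrite conductorsE //; have [n2|n2] := ltnP 2 n; last first.
    suff -> : Y :\: [set y in Y | l y <= 1 < r y] = set0 by rewrite cards0.
    apply/setP=> y; rewrite !inE; case yY: (y \in Y); rewrite ?andbF //=.
    by have := lr y yY; lia.
  apply: leq_trans (card_nested 2 n isT n2 (leqnn n) _); last by case.
  apply/subset_leq_card/subsetP=> y; rewrite !inE.
  case yY: (y \in Y); rewrite ?andbF //=.
  by have := lr y yY; lia.
have [z zS] : exists z, z \in conductors e x 1 by apply/card_gt0P; lia.
have [y1 m1] := min_level_exists _ _ zS.
have [z' zS'] : exists z, z \in conductors e x 1 :\ y1.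
  by apply/card_gt0P; rewrite (cardsD1 y1) m1.1 in c2.
have [y2 m2] := min_level_exists _ _ zS'.
by exists (State y1 y2 [:: y1; x 1; y2]); constructor.
Qed.

Lemma middle_step_exists i st : 1 < i < n -> reached e n x i.-1 st ->
  exists st', middle_step e n x i st st'.
Proof.
move=> Hi /reached_invariant [|Hi1 inv]; first lia.
case: i Hi Hi1 inv => // i /= Hi Hi1; case: st => a b s /= inv.
have [z zS] : exists y, y \in unlabeled_conductors e x i.+1 s.
  by apply: unlabeled_conductor_exists inv; lia.
have [y ymin] := min_level_exists _ _ zS.
have [/and3P[aY la ra] /and3P[bY lb rb]] :=
  (inv_endA _ _ _ _ inv, inv_endB _ _ _ _ inv).
suff [ext|ext] : extendable e n x i.+1 a b \/ extendable e n x i.+1 b a.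
- by exists (State y b [:: y, x i.+1 & s]); constructor.
- by exists (State a y (rcons (rcons s (x i.+1)) y)); constructor.
(* Both levels are at least i + 1: one of them equals i + 1, or both exceed it. *)
rewrite /extendable !levelE //.
have [?|?] := eqVneq (r a) i.+1; first by left; left.
have [?|?] := eqVneq (r b) i.+1; first by right; left.
by case: (leqP (r a) (r b)) => ?; [left|right]; right; split; lia.
Qed.

(** After step n - 1 the path carries n = |Y| vertices of [Y], and both endpoints have level n,
    hence are adjacent to [x n]. *)
Lemma outputs_hamiltonian c : 1 < n ->
  (forall v, v \in Y \/ exists2 j, 1 <= j <= n & v = x j) ->
  outputs e n x c -> hamiltonian_cycle I c.
Proof.
move=> n1 cover [st /(reached_invariant _ _ n1)[Hn]].
case: st => a b s /= inv.
have labelsE : [set y in Y | y \in s] = Y.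
  apply/eqP; rewrite eqEcard card_Y (inv_card _ _ _ _ inv) prednK; last lia.
  by rewrite leqnn andbT; apply/subsetP=> y; rewrite inE => /andP[].
case: (inv) => [[t [st lt pt]] us /and3P[aY la ra] /and3P[bY lb rb]].
move=> _ ic ix _ _.
have adj z : z \in Y -> n.-1 < r z -> I (x n) z.
  move=> zY rz; have /and3P[l1 l2 l3] := lr z zY.
  by rewrite /I /interval_graph e_xY //; lia.
split.
- rewrite size_rcons ltnS; apply: leq_trans (card_size s).
  apply: leq_trans (_ : #|[set y in Y | y \in s]| <= _).
    by rewrite ic; lia.
  by apply/subset_leq_card/subsetP=> z; rewrite inE => /andP[].
- rewrite st /= !rcons_path pt lt last_rcons adj // andbT.
  by rewrite I_sym adj.
- by rewrite rcons_uniq us andbT ix; lia.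
- move=> v; rewrite mem_rcons inE; have [vY|[j Hj ->]] := cover v.
    by move: vY; rewrite -labelsE inE => /andP[_ ->]; rewrite orbT.
  rewrite ix //; have [->|jn] := eqVneq j n; first by rewrite eqxx.
  by apply/orP; right; lia.
Qed.

End Run.

(** * From Property A to intervals *)

Theorem theorem2 (V : finType) (e : rel V) (X Y : {set V}) (n : nat)
    (x : nat -> V) (hG : convex_bipartite e X Y n x)
    (hA : propertyA e Y n x) :
  never_stuck e n x /\
  (forall c : seq V, outputs e n x c ->
     hamiltonian_cycle (interval_graph e Y) c).
Proof.
have [[e_sym _] _ [XY disXY eXY] [x_uniq XE] convex] := hG.
have [nested _ [cardN1 cardN2]] := hA.
have x_inj i j : 1 <= i <= n -> 1 <= j <= n -> x i = x j -> i = j.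
  move=> Hi Hj xij; have /(uniqP (x 0)) := x_uniq.
  rewrite size_map size_iota => /(_ i.-1 j.-1); rewrite !inE.
  rewrite !(nth_map 0) ?size_iota ?nth_iota; try lia.
  by rewrite !add1n !prednK; try lia; move=> /(_ _ _ xij); lia.
have Xint_mem p q i : 1 <= i <= n -> 1 <= p -> q <= n ->
    (x i \in Xint x p q) = (p <= i <= q).
  move=> Hi p1 qn; rewrite inE; apply/mapP/idP => [[j]|Hpq]; last first.
    by exists i => //; rewrite mem_index_iota.
  by rewrite mem_index_iota => Hj /x_inj -> //; lia.
have Xint_sub p q p' q' : p' <= p -> q <= q' -> Xint x p q \subset Xint x p' q'.
  move=> Hp Hq; apply/subsetP=> v; rewrite !inE => /mapP[j].
  by rewrite mem_index_iota => Hj ->; rewrite map_f // mem_index_iota; lia.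
have XP v : v \in X -> exists2 j, 1 <= j <= n & v = x j.
  by rewrite XE inE => /mapP[j]; rewrite mem_index_iota => Hj ->; exists j.
have xX i : 1 <= i <= n -> x i \in X by move=> Hi; rewrite XE Xint_mem.
have XNY v : v \in X -> v \notin Y.
  by move=> vX; have /disjointFr/(_ vX) -> := disXY.
have card_Y : #|Y| = n.
  rewrite -[RHS]cardN1; apply: eq_card => y; rewrite inE.
  case yY: (y \in Y) => //=; apply/esym.
  have [p [q [p1 qn ->]]] := convex y yY; exact: Xint_sub.
(* By part (3) of Property A all of [Y] has two neighbours or more, whence [l y < r y]. *)
have Y2 y : y \in Y -> 1 < #|nbh e y|.
  have <- : Ntwo e Y x 1 n = Y.
    apply/eqP; rewrite eqEcard card_Y cardN2 leqnn andbT.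
    by apply/subsetP=> z; rewrite inE => /andP[].
  rewrite inE => /andP[_ H]; apply: leq_trans H _.
  by apply/subset_leq_card/subsetIl.
have [lr lrP] : exists lr : V -> nat * nat, forall y, y \in Y ->
    [/\ 1 <= (lr y).1, (lr y).1 < (lr y).2, (lr y).2 <= n &
        nbh e y = Xint x (lr y).1 (lr y).2].
  apply: (fin_all_exists (P := fun y (pq : nat * nat) => y \in Y ->
    [/\ 1 <= pq.1, pq.1 < pq.2, pq.2 <= n & nbh e y = Xint x pq.1 pq.2])) => y.
  (* Outside [Y] the pair is a dummy value. *)
  case yY: (y \in Y); last by exists (0, 0).
  have [p [q [p1 qn nE]]] := convex y yY; exists (p, q) => _; split=> //=.
  rewrite ltnNge; apply/negP=> qp; have := Y2 y yY.
  rewrite ltnNge => /negP; apply; rewrite nE -(cards1 (x p)).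
  apply/subset_leq_card/subsetP=> v; rewrite !inE => /mapP[j].
  by rewrite mem_index_iota => Hj ->; have -> : j = p by lia.
have x_notin_Y i : 1 <= i <= n -> x i \notin Y by move/xX/XNY.
have e_xY i y : 1 <= i <= n -> y \in Y ->
    e (x i) y = ((lr y).1 <= i <= (lr y).2).
  move=> Hi yY; have [l1 l2 l3 nE] := lrP y yY.
  by rewrite e_sym -(Xint_mem (lr y).1 (lr y).2 i) // -nE inE.
have e_xx i j : 1 <= i <= n -> 1 <= j <= n -> e (x i) (x j) = false.
  move=> Hi Hj; apply/negP=> /eXY.
  by rewrite (negbTE (x_notin_Y i Hi)) (negbTE (x_notin_Y j Hj)) andbF.
have cliqueE i y : 1 <= i <= n -> y \in Y ->
    (y \in clique e x i) = ((lr y).1 <= i <= (lr y).2).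
  move=> Hi yY; rewrite !inE e_xY //; case: eqP => // yx.
  by have := x_notin_Y i Hi; rewrite -yx yY.
have clique_x i j : 1 <= i <= n -> 1 <= j <= n ->
    (x j \in clique e x i) = (i == j).
  move=> Hi Hj; rewrite !inE e_xx // orbF.
  by apply/eqP/eqP=> [/x_inj->|->].
have cover v : v \in Y \/ exists2 j, 1 <= j <= n & v = x j.
  by have := in_setT v; rewrite -XY inE => /orP[/XP|]; [right | left].
have conductorsE i : 1 <= i < n ->
    conductors e x i = [set y in Y | (lr y).1 <= i < (lr y).2].
  move=> Hi; apply/setP=> v; rewrite in_setI inE.
  have [vY|[j Hj ->]] := cover v; last first.
    by rewrite (negbTE (x_notin_Y j Hj)) !clique_x //; lia.
  by rewrite vY !cliqueE //; lia.
have levelE y : y \in Y -> level e n x y = (lr y).2.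
  move=> yY; have [l1 l2 l3 _] := lrP y yY; apply/eqP; rewrite eqn_leq.
  apply/andP; split.
    apply/bigmax_leqP_seq=> i; rewrite mem_index_iota => Hi.
    by rewrite cliqueE //; lia.
  by apply: leq_bigmax_seq; rewrite ?mem_index_iota ?cliqueE //; lia.
have n1 : 1 < n.
  case: (set_0Vmem Y) => [Y0|[y /lrP[*]]]; last lia.
  have n0 : n = 0 by rewrite -card_Y Y0 cards0.
  (* [x 0] only witnesses that [V] is inhabited, while empty [Y] and n = 0 would leave no vertex. *)
  by have [|[j Hj _]] := cover (x 0); [rewrite Y0 inE | lia].
have card_nested p q : 1 <= p -> p < q -> q <= n -> (p, q) <> (1, n) ->
    #|[set y in Y | (p <= (lr y).1) && ((lr y).2 <= q)]| <= q - p.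
  move=> p1 pq qn neq; apply: leq_trans (nested p q p1 pq qn neq).
  apply/subset_leq_card/subsetP=> y; rewrite !inE => /and3P[yY py yq].
  by rewrite yY; have [_ _ _ ->] := lrP y yY; exact: Xint_sub.
have lrY y : y \in Y -> [&& 1 <= (lr y).1, (lr y).1 < (lr y).2 & (lr y).2 <= n].
  by move=> /lrP[-> -> ->].
pose l y := (lr y).1; pose r y := (lr y).2.
split; first split.
- exact: (first_step_exists V e Y n x l r).
- exact: (middle_step_exists V e Y n x l r).
- move=> c.
  exact: (outputs_hamiltonian V e Y n x l r).
Qed.
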